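(* Let $(\mathcal{X},\Delta)$ be a separable metric space, $\Omega$ a measurable space with a finite positive measure $\mu$, and $\varphi:[0,\infty)\times\Omega\to\mathbb{C}$ a map such that $\varphi(\delta,\cdot)$ is in $L_2(\Omega,\mu)$ for every $\delta\in[0,\infty)$, while $\varphi(\cdot,\omega)$ is a continuous radial basis function on $(\mathcal{X},\Delta)$ for every $\omega\in\Omega$. Then $$\psi(\delta)=\int_\Omega\varphi(\delta,\omega)\,d\mu(\omega),\qquad\delta\in[0,\infty),$$ is also a radial basis function on $(\mathcal{X},\Delta)$.
   Context: A map $\varphi:[0,\infty)\to\mathbb{C}$ is called a radial basis function on a metric space $(\mathcal{X},\Delta)$ if $H(x,y)=\varphi(\Delta(x,y))$, $x,y\in\mathcal{X}$, is a reproducing kernel, i.e. if there is a Hilbert space $\mathcal{H}$ of functions $\mathcal{X}\to\mathbb{C}$ with $H(\cdot,y)\in\mathcal{H}$ and $f(y)=\langle f,H(\cdot,y)\rangle$ for all $f\in\mathcal{H}$, $y\in\mathcal{X}$. *)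

(* Defs.v *)
From HB Require Import structures.
From mathcomp Require Import all_boot all_order all_algebra.
From mathcomp Require Import sesquilinear complex.
From mathcomp Require Import all_classical all_reals all_analysis.
Set Implicit Arguments.
Unset Strict Implicit.
Unset Printing Implicit Defensive.
Import Order.TTheory GRing.Theory Num.Theory.
Import numFieldNormedType.Exports.
Local Open Scope classical_set_scope.
Local Open Scope ring_scope.

(* {dot H for Num.conj}: linear in the first argument, conjugate-linear in the
   second, Hermitian and positive definite; [ip u u] is thus a nonnegative
   real. *)
Definition ipnorm (R : realType) (H : lmodType R[i]) (ip : {dot H for Num.conj})
    (u : H) : R :=
  Num.sqrt (complex.Re (ip u u)).

(* Completeness of the inner product space (H, ip) for the norm [ipnorm ip]. *)
Definition hilbert (R : realType) (H : lmodType R[i])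
    (ip : {dot H for Num.conj}) : Prop :=
  forall u : nat -> H,
    (forall e : R, 0 < e -> exists N : nat, forall m n : nat,
       (N <= m)%N -> (N <= n)%N -> ipnorm ip (u m - u n) < e) ->
    exists l : H, ipnorm ip (u n - l) @[n --> \oo] --> (0 : R).

(* [subLmodType S] with [S : {pred X -> R[i]}] is a linear subspace of the space
   of all functions X -> R[i] (pointwise operations); [\val] is the inclusion. *)
Definition reproducing_kernel (R : realType) (X : Type)
    (K : X -> X -> R[i]) : Prop :=
  exists (S : {pred X -> R[i]}) (H : subLmodType S)
    (ip : {dot H for Num.conj}),
    hilbert ip /\
    forall y : X, exists2 Ky : H, \val Ky = (fun x => K x y) &
      forall f : H, (\val f : X -> R[i]) y = ip f Ky.

(* Functions on [0, +oo[ are represented by functions on R whose values at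
   negative arguments are irrelevant: [mdist x y >= 0]. *)
Definition radial_basis_function (R : realType) (X : metricType R)
    (phi : R -> R[i]) : Prop :=
  reproducing_kernel (fun x y : X => phi (mdist x y)).

Definition separable_space (T : topologicalType) : Prop :=
  exists2 D : set T, countable D & dense D.

(* A complex function is measurable iff its real and imaginary parts are;
   [normc] is the R-valued modulus. *)
Definition L2c (R : realType) (d : measure_display) (T : measurableType d)
    (mu : {measure set T -> \bar R}) (f : T -> R[i]) : Prop :=
  [/\ measurable_fun setT (fun t => complex.Re (f t)),
      measurable_fun setT (fun t => complex.Im (f t)) &
      finite_norm mu 2%:E (fun t => ComplexField.Normc.normc (f t))].

Definition integralc (R : realType) (d : measure_display) (T : measurableType d)
    (mu : {measure set T -> \bar R}) (f : T -> R[i]) : R[i] :=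
  Complex (\int[mu]_t complex.Re (f t)) (\int[mu]_t complex.Im (f t)).

(* Main.v *)
Require Import Defs.
From HB Require Import structures.
From mathcomp Require Import all_boot all_order all_algebra.
From mathcomp Require Import sesquilinear complex.
From mathcomp Require Import all_classical all_reals all_analysis.
From mathcomp Require Import measurable_realfun.
From mathcomp Require Import ring.
Set Implicit Arguments.
Unset Strict Implicit.
Unset Printing Implicit Defensive.
Import Order.TTheory GRing.Theory Num.Theory.
Import numFieldNormedType.Exports.
Local Open Scope classical_set_scope.
Local Open Scope ring_scope.

(** A kernel is reproducing if and only if it is Hermitian and positive
semidefinite, and these two conditions are pointwise (in)equalities between
finite linear combinations of values of the kernel, so they survive
integration. For a fixed choice of points x_i and scalars c_i, the function
omega |-> sum_ij c_i (c_j)^* phi(Delta(x_j, x_i), omega) is nonnegative and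
integrable, because a square-integrable function is integrable for a finite
measure; hence the corresponding sum for psi is the integral of a nonnegative
function.

The easy half of the characterisation is [reproducing_kernel_pd]: the quadratic
form of the kernel is the squared norm of sum_i c_i K(., x_i). The other half,
[pd_kernel_reproducing], is the Moore-Aronszajn theorem. The Hilbert space is
obtained without an abstract completion. A formal combination s of points acts
on any function f by the pairing <f, s> = sum_i (c_i)^* f(x_i), which is what
the inner product of f with the kernel combination of s has to be. A function
is said to be bounded by M when |<f, s>| <= M ||s|| for all s, where ||s|| is
the seminorm that the kernel defines on formal combinations; this is a dual
norm, and kernel combinations are bounded by their own seminorm by
Cauchy-Schwarz. The native space consists of the functions that kernel
combinations approximate in the dual norm, and the inner product of f and g is
the limit of the pairings of f with combinations approximating g. Point
evaluations are pairings, so the reproducing property is an instance of the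
compatibility of the inner product with the pairing ([native_ip_kcomb]), and
completeness follows from the fact that a pointwise limit inherits the bounds
of the dual norm ([native_hilbert]). *)

(** * Convergence of complex sequences *)

Section ComplexSequences.
Variable R : realType.
Local Notation C := R[i].
Local Notation "u ~> z" := ((u : nat -> C^o) @ \oo --> (z : C^o))
  (at level 70).
Implicit Types (u v : nat -> C) (z w : C).

Lemma cvgC_Re u z : u ~> z ->
  (fun n => complex.Re (u n)) @ \oo --> complex.Re z.
Proof.
move=> /cvgrPdist_lt uz; apply/cvgrPdist_lt => e e0.
have := uz e%:C%C; rewrite ltcR => /(_ e0); apply: filterS => n.
by rewrite -raddfB -ltcR; apply: le_lt_trans; exact: normc_ge_Re.
Qed.

Lemma normC_ge_Im z : `|complex.Im z|%:C%C <= `|z|.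
Proof.
rewrite -[complex.Im z]opprK -ReiNIm normrN (le_trans (normc_ge_Re _))//.
by rewrite normrM complexiE normCi mulr1.
Qed.

Lemma cvgC_Im u z : u ~> z ->
  (fun n => complex.Im (u n)) @ \oo --> complex.Im z.
Proof.
move=> /cvgrPdist_lt uz; apply/cvgrPdist_lt => e e0.
have := uz e%:C%C; rewrite ltcR => /(_ e0); apply: filterS => n.
by rewrite -raddfB -ltcR; apply: le_lt_trans; exact: normC_ge_Im.
Qed.

Lemma cvgC_norm u z : u ~> z -> (fun n => `|u n|) ~> `|z|.
Proof.
move=> /cvgrPdist_lt uz; apply/cvgrPdist_lt => e e0.
by apply: filterS (uz e e0) => n; apply: le_lt_trans; exact: ler_dist_dist.
Qed.

Lemma cvgC_conj u z : u ~> z -> (fun n => (u n)^*) ~> z^*.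
Proof.
move=> /cvgrPdist_lt uz; apply/cvgrPdist_lt => e e0.
by apply: filterS (uz e e0) => n; rewrite -rmorphB norm_conjC.
Qed.

Lemma normC_le_ReIm z : `|z| <= (`|complex.Re z| + `|complex.Im z|)%:C%C.
Proof.
rewrite {1}[z]complexE rmorphD /=.
apply: (le_trans (ler_normD _ _)); rewrite normrM.
have normi : `|'i%C : C| = 1 by rewrite complexiE normCi.
rewrite normi mul1r.
have normRC (x : R) : `|x%:C%C : C| = `|x|%:C%C.
  by rewrite normc_def /= expr0n addr0 sqrtr_sqr.
by rewrite !normRC.
Qed.

Lemma cvgC_ReIm u z :
  (fun n => complex.Re (u n)) @ \oo --> complex.Re z ->
  (fun n => complex.Im (u n)) @ \oo --> complex.Im z -> u ~> z.
Proof.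
move=> /cvgrPdist_lt uR /cvgrPdist_lt uI; apply/cvgrPdist_lt => e e0.
have eE : e = (complex.Re e)%:C%C by rewrite RRe_real// gtr0_real.
have Re0 : 0 < complex.Re e / 2 by rewrite divr_gt0// -ltcR -eE.
near=> n; rewrite eE (le_lt_trans (normC_le_ReIm _))// ltcR.
rewrite [ltRHS]splitr ltrD// raddfB/=.
- by near: n; exact: uR.
- by near: n; exact: uI.
Unshelve. all: by end_near. Qed.

Lemma cvgC_real (r : nat -> R) (x : R) :
  r @ \oo --> x -> (fun n => (r n)%:C%C) ~> x%:C%C.
Proof. by move=> rx; apply: cvgC_ReIm => //=; exact: cvg_cst. Qed.

Lemma cvgC_invn : (fun n => n.+1%:R^-1 : C) ~> 0.
Proof.
have -> : (fun n => n.+1%:R^-1 : C) = (fun n => (n.+1%:R^-1 : R)%:C%C).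
  by apply/funext => n; rewrite fmorphV rmorph_nat.
by apply: cvgC_real; exact: cvg_harmonic.
Qed.

(** Completeness of the complex numbers, from that of the reals. *)
Lemma cvgC_cauchy u :
  (forall e : R, 0 < e -> exists N, forall m n, (N <= m)%N -> (N <= n)%N ->
     `|u m - u n| <= e%:C%C) ->
  u ~> lim ((u : nat -> C^o) @ \oo).
Proof.
move=> uC; apply/cvg_ex.
have cvgR (g : C -> R) : {morph g : z w / z - w} ->
    (forall z, `|g z|%:C%C <= `|z|) -> cvg ((fun n => g (u n)) @ \oo).
  move=> gB gle; apply/cauchy_cvgP/cauchy_exP => e e0.
  have [N uN] := uC _ (divr_gt0 e0 (ltr0Sn _ 1)).
  exists (g (u N)); exists N => // n /= Nn; rewrite /ball/= -gB.
  rewrite (@le_lt_trans _ _ (e / 2))//; last first.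
    by rewrite ltr_pdivrMr// ltr_pMr// ltr1n.
  by rewrite -lecR (le_trans (gle _))// uN.
have uR : cvg ((fun n => complex.Re (u n)) @ \oo).
  by apply: (cvgR (@complex.Re R)) => [? ?|z]; [exact: raddfB|exact: normc_ge_Re].
have uI : cvg ((fun n => complex.Im (u n)) @ \oo).
  by apply: (cvgR (@complex.Im R)) => [? ?|z]; [exact: raddfB|exact: normC_ge_Im].
exists (Complex (lim ((fun n => complex.Re (u n)) @ \oo))
                (lim ((fun n => complex.Im (u n)) @ \oo))).
exact: cvgC_ReIm.
Qed.

Lemma ge0_cvgC u z : u ~> z -> (\forall n \near \oo, 0 <= u n) -> 0 <= z.
Proof.
move=> uz u0; rewrite lecE; apply/andP; split.
  apply/eqP => /=.
  have uI := cvgC_Im uz.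
  have u0' : (fun n => complex.Im (u n)) @ \oo --> (0 : R).
    apply: cvg_near_cst; apply: filterS u0 => n /ger0_Im ->//.
  exact: (cvg_unique _ uI u0').
have uR := cvgC_Re uz.
apply: (@cvgr_to_ge _ _ _ _ _ _ _ uR); apply: filterS u0 => n.
by rewrite lecE => /andP[].
Qed.

Lemma le_norm_cvgC u v z w : u ~> z -> v ~> w ->
  (\forall n \near \oo, `|u n| <= v n) -> `|z| <= w.
Proof.
move=> uz vw uv; rewrite -subr_ge0.
apply: (@ge0_cvgC (fun n => v n - `|u n|)).
  exact: (cvgB vw (cvgC_norm uz)).
by apply: filterS uv => n; rewrite subr_ge0.
Qed.

Lemma squeeze0C u v z : v ~> 0 -> (forall n, `|z - u n| <= v n) -> u ~> z.
Proof.
move=> /cvgrPdist_lt v0 uv; apply/cvgrPdist_lt => e e0.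
apply: filterS (v0 e e0) => n; rewrite sub0r normrN.
apply: le_lt_trans; apply: (le_trans (uv n)).
by rewrite real_ler_norm// ger0_real// (le_trans _ (uv n)).
Qed.
End ComplexSequences.

(** * Combinations of points and kernels *)

(** The Cauchy-Schwarz inequality reduced to the coefficients of the form on a
plane: [P], [Q], [Z] stand for <u, u>, <v, v>, <u, v> and the hypothesis is the
nonnegativity of <a u + b v, a u + b v>. The form may be degenerate. *)
Lemma cauchy_schwarz_coef (C : numClosedFieldType) (P Q Z : C) :
  0 <= P -> 0 <= Q ->
  (forall a b, 0 <= a * a^* * P + a * b^* * Z + b * a^* * Z^* + b * b^* * Q) ->
  `|Z| <= sqrtC P * sqrtC Q.
Proof.
move=> P0 Q0 pos.
rewrite -(@ler_pXn2r _ 2) ?nnegrE ?mulr_ge0 ?sqrtC_ge0// exprMn !sqrtCK.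
have [Q00|Qneq0] := eqVneq Q 0.
  (* The form at |Z|^2 u - (P + 1) Z v is - |Z|^4 (P + 2), hence Z = 0. *)
  have := pos (`|Z| * `|Z|) (- (P + 1) * Z).
  rewrite Q00 mulr0 addr0 mulr0.
  rewrite !(rmorphM, rmorphN, rmorphD, rmorph1)/= !conj_normC (geC0_conj P0).
  have -> : `|Z| * `|Z| * (`|Z| * `|Z|) * P +
      `|Z| * `|Z| * (- (P + 1) * Z^*) * Z +
      - (P + 1) * Z * (`|Z| * `|Z|) * Z^* =
      - ((Z * Z^*) * `|Z| ^+ 2 * (P + 2)) +
      (`|Z| ^+ 2 - Z * Z^*) * `|Z| ^+ 2 * P by ring.
  rewrite -normCK subrr !mul0r addr0 oppr_ge0 -exprD => Zle.
  suff -> : Z = 0 by rewrite normr0 expr0n.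
  apply/eqP; rewrite -normr_eq0 -sqrf_eq0 -sqrf_eq0 -exprM.
  have P2 : 0 < P + 2 by rewrite ltr_wpDl.
  move: Zle; rewrite pmulr_lle0// => Zle.
  by rewrite eq_le Zle exprn_ge0.
have Qgt0 : 0 < Q by rewrite lt_def Qneq0.
have := pos Q (- Z); rewrite rmorphN (geC0_conj Q0).
have -> : Q * Q * P + Q * - Z^* * Z + - Z * Q * Z^* + - Z * - Z^* * Q =
  Q * (P * Q - Z * Z^*) by ring.
by rewrite -normCK pmulr_rge0// subr_ge0.
Qed.

Section Pairing.
Variables (R : realType) (X : Type).
Local Notation C := R[i].
Local Notation "u ~> z" := ((u : nat -> C^o) @ \oo --> (z : C^o))
  (at level 70).
Implicit Types (f g : X -> C) (s t : seq (C * X)) (K : X -> X -> C).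

(** The value that the inner product of [f] with [kcomb K s] is forced to have by
the reproducing property; it makes sense for an arbitrary function [f]. *)
Definition pairing f s : C := \sum_(p <- s) p.1^* * f p.2.

Definition kcomb K s : X -> C := fun x => \sum_(p <- s) p.1 * K x p.2.

Definition scale_comb (a : C) s := [seq (a * p.1, p.2) | p <- s].

Lemma pairing_cat f s t : pairing f (s ++ t) = pairing f s + pairing f t.
Proof. by rewrite /pairing big_cat. Qed.

Lemma pairing_scale f a s : pairing f (scale_comb a s) = a^* * pairing f s.
Proof.
rewrite /pairing big_map mulr_sumr; apply: eq_bigr => p _.
by rewrite rmorphM/= mulrA.
Qed.

Lemma pairing_linear a f g s :
  pairing (a *: f + g) s = a * pairing f s + pairing g s.
Proof.
rewrite /pairing mulr_sumr -big_split; apply: eq_bigr => p _.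
by rewrite addrfctE scalrfctE/= mulrDr mulrCA.
Qed.

Lemma pairingD f g s : pairing (f + g) s = pairing f s + pairing g s.
Proof. by rewrite -[f]scale1r pairing_linear mul1r scale1r. Qed.

Lemma pairingZ a f s : pairing (a *: f) s = a * pairing f s.
Proof.
have := pairing_linear a f 0 s; rewrite addr0 => ->.
by rewrite [X in _ + X]big1 ?addr0// => p _; rewrite mulr0.
Qed.

Lemma pairingN f s : pairing (- f) s = - pairing f s.
Proof. by rewrite -scaleN1r pairingZ mulN1r. Qed.

Lemma pairingB f g s : pairing (f - g) s = pairing f s - pairing g s.
Proof. by rewrite pairingD pairingN. Qed.

Lemma pairing1 f x : pairing f [:: (1, x)] = f x.
Proof. by rewrite /pairing big_seq1 rmorph1 mul1r. Qed.

Lemma kcomb_cat K s t : kcomb K (s ++ t) = kcomb K s + kcomb K t.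
Proof. by apply/funext => x; rewrite /kcomb big_cat. Qed.

Lemma kcomb_scale K a s : kcomb K (scale_comb a s) = a *: kcomb K s.
Proof.
apply/funext => x; rewrite /kcomb big_map scalrfctE /= [RHS]mulr_sumr.
by apply: eq_bigr => p _; rewrite /= mulrA.
Qed.

Lemma kcomb1 K x : kcomb K [:: (1, x)] = K^~ x.
Proof. by apply/funext => y; rewrite /kcomb big_seq1 mul1r. Qed.

Lemma cvg_pairing (u : nat -> X -> C) f s : (forall x, u^~ x ~> f x) ->
  (fun n => pairing (u n) s) ~> pairing f s.
Proof.
move=> uf; rewrite /pairing.
elim: s => [|p s ih].
  by under eq_fun do rewrite big_nil; rewrite big_nil; exact: cvg_cst.
under eq_fun do rewrite big_cons; rewrite big_cons.
apply: cvgD => //; apply: cvgM; [exact: cvg_cst|exact: uf].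
Qed.

End Pairing.

(** Bundling the kernel with its properties lets the algebraic structures of its
native space be inferred from the kernel alone. The quadratic form of a
combination is its pairing with its own kernel combination. *)
Record pd_kernel (R : realType) (X : Type) := PdKernel {
  kernel_fun :> X -> X -> R[i];
  kernel_herm : forall x y, kernel_fun y x = (kernel_fun x y)^*;
  kernel_psd : forall s, 0 <= pairing (kcomb kernel_fun s) s }.

(** * The native space of a positive definite kernel *)

Section NativeSpace.
Variables (R : realType) (X : Type) (K : pd_kernel R X).
Local Notation C := R[i].
Local Notation "u ~> z" := ((u : nat -> C^o) @ \oo --> (z : C^o))
  (at level 70).
Implicit Types (f g h : X -> C) (s t : seq (C * X)) (M e : C).

Definition gram s t : C := pairing (kcomb K s) t.

Lemma gram_conj s t : gram t s = (gram s t)^*.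
Proof.
rewrite /gram /pairing rmorph_sum /=.
under eq_bigr do rewrite mulr_sumr.
rewrite exchange_big; apply: eq_bigr => p _.
rewrite rmorphM/= conjCK /kcomb rmorph_sum mulr_sumr; apply: eq_bigr => q _.
by rewrite rmorphM/= -kernel_herm mulrCA.
Qed.

Definition comb_norm s : C := sqrtC (gram s s).

Lemma comb_norm_ge0 s : 0 <= comb_norm s.
Proof. by rewrite sqrtC_ge0; exact: kernel_psd. Qed.

Lemma comb_normK s : gram s s = comb_norm s ^+ 2.
Proof. by rewrite sqrtCK. Qed.

Lemma gram_cauchy_schwarz s t : `|gram s t| <= comb_norm s * comb_norm t.
Proof.
apply: cauchy_schwarz_coef; [exact: kernel_psd..|move=> a b].
have := kernel_psd K (scale_comb a s ++ scale_comb b t).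
rewrite kcomb_cat !kcomb_scale pairing_cat !pairingD !pairingZ !pairing_scale.
rewrite -!/(gram _ _) (gram_conj s t).
by congr (0 <= _); ring.
Qed.

(** [M] is an upper bound for the norm of [f] as an antilinear functional on formal
combinations. *)
Definition bounded_by f M := forall t, `|pairing f t| <= M * comb_norm t.

Lemma bounded_byD f g M N :
  bounded_by f M -> bounded_by g N -> bounded_by (f + g) (M + N).
Proof.
move=> fM gN t; rewrite pairingD mulrDl.
by rewrite (le_trans (ler_normD _ _))// lerD.
Qed.

Lemma bounded_byZ a f M : bounded_by f M -> bounded_by (a *: f) (`|a| * M).
Proof. by move=> fM t; rewrite pairingZ normrM -mulrA ler_wpM2l. Qed.

Lemma bounded_by_le f M N : M <= N -> bounded_by f M -> bounded_by f N.
Proof.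
move=> MN fM t; rewrite (le_trans (fM t))// ler_wpM2r//.
exact: comb_norm_ge0.
Qed.

Lemma bounded_byN f M : bounded_by f M -> bounded_by (- f) M.
Proof. by move=> fM t; rewrite pairingN normrN. Qed.

Lemma bounded_by_kcomb s : bounded_by (kcomb K s) (comb_norm s).
Proof. by move=> t; exact: gram_cauchy_schwarz. Qed.

(** On kernel combinations the dual norm dominates the seminorm: test the
functional on [s] itself. *)
Lemma comb_norm_le s M : 0 <= M -> bounded_by (kcomb K s) M -> comb_norm s <= M.
Proof.
move=> M0 sM; have := sM s; rewrite -/(gram s s) comb_normK.
have := comb_norm_ge0 s; rewrite le_eqVlt => /predU1P[<-//|s0].
by rewrite normrX (gtr0_norm s0) expr2 ler_pM2r.
Qed.

(** The closure of the kernel combinations for the dual norm. *)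
Definition native_set : {pred X -> C} := fun f =>
  `[< forall e, 0 < e -> exists s, bounded_by (f - kcomb K s) e >].

Lemma native_setP f :
  (forall e, 0 < e -> exists s, bounded_by (f - kcomb K s) e) <->
  f \in native_set.
Proof. by split=> [?|/asboolP//]; exact/asboolP. Qed.

Lemma native_set_submod : submod_closed native_set.
Proof.
split=> [|a f g /native_setP fS /native_setP gS].
  apply/native_setP => e e0; exists [::] => t.
  rewrite pairingB /pairing !big1 => [|p _|p _]; last 2 first.
  - by rewrite /kcomb big_nil mulr0.
  - by rewrite mulr0.
  by rewrite subr0 normr0 mulr_ge0 ?comb_norm_ge0// ltW.
apply/native_setP => e e0.
have a0 : 0 < 1 + `|a| by rewrite ltr_pwDl.
have e20 : 0 < e / 2 by rewrite divr_gt0.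
have [s fs] := fS _ (divr_gt0 e20 a0).
have [t gt] := gS _ e20.
exists (scale_comb a s ++ t); rewrite kcomb_cat kcomb_scale.
have -> : a *: f + g - (a *: kcomb K s + kcomb K t) =
    a *: (f - kcomb K s) + (g - kcomb K t).
  by rewrite opprD addrACA scalerBr.
apply: bounded_by_le (bounded_byD (bounded_byZ a fs) gt).
rewrite [leRHS]splitr lerD// mulrCA ler_piMr//; first exact: ltW.
by rewrite ler_pdivrMr// mul1r lerDr.
Qed.

HB.instance Definition _ :=
  GRing.isSubmodClosed.Build C (X -> C : lmodType C) native_set native_set_submod.

Definition native_space := {f : X -> C | f \in native_set}.
HB.instance Definition _ := SubType.on native_space.
HB.instance Definition _ := [Choice of native_space by <:].
HB.instance Definition _ :=
  [SubChoice_isSubLmodule of native_space by <:].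

Lemma kcomb_nil : kcomb K [::] = 0.
Proof. by apply/funext => x; rewrite /kcomb big_nil. Qed.

Lemma native_kcomb s : kcomb K s \in native_set.
Proof.
apply/native_setP => e e0; exists s => t.
rewrite pairingB subrr normr0 mulr_ge0 ?comb_norm_ge0//; exact: ltW.
Qed.

Lemma native_bounded f : f \in native_set -> exists2 M, 0 <= M & bounded_by f M.
Proof.
move=> /native_setP /(_ 1 ltr01)[s fs]; exists (1 + comb_norm s).
  by rewrite addr_ge0// comb_norm_ge0.
by rewrite -[f](subrK (kcomb K s)); apply: bounded_byD => //; exact: bounded_by_kcomb.
Qed.

(** The default [[::]] is only reached outside [native_set]. *)
Definition approx f (n : nat) : seq (C * X) :=
  if pselect (exists s, bounded_by (f - kcomb K s) n.+1%:R^-1) is left fs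
  then projT1 (cid fs) else [::].

Lemma approxP f n : f \in native_set ->
  bounded_by (f - kcomb K (approx f n)) n.+1%:R^-1.
Proof.
move=> /native_setP fS; rewrite /approx.
case: pselect => [fs|[]]; first exact: projT2 (cid fs).
by apply: fS; rewrite invr_gt0 ltr0n.
Qed.

(** With this definition linearity in [f] is immediate, and Hermitian symmetry
has to be proved: see [native_ip_gram]. *)
Definition native_ip f g : C :=
  lim ((fun n => pairing f (approx g n) : C^o) @ \oo).

(** The difference is the pairing of [f] with the formal difference of [s] and
[t], whose seminorm is at most [e + d] since [kcomb K s] and [kcomb K t] are both
close to [g]. *)
Lemma pairing_approx f g s t M e d : 0 <= M -> 0 <= e -> 0 <= d ->
  bounded_by f M ->
  bounded_by (g - kcomb K s) e -> bounded_by (g - kcomb K t) d ->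
  `|pairing f s - pairing f t| <= M * (e + d).
Proof.
move=> M0 e0 d0 fM gs gt.
have -> : pairing f s - pairing f t = pairing f (s ++ scale_comb (-1) t).
  by rewrite pairing_cat pairing_scale rmorphN rmorph1 mulN1r.
rewrite (le_trans (fM _))// ler_wpM2l// comb_norm_le ?addr_ge0//.
rewrite kcomb_cat kcomb_scale scaleN1r.
have -> : kcomb K s - kcomb K t = - (g - kcomb K s) + (g - kcomb K t).
  by rewrite opprB addrA subrK.
by apply: bounded_byD => //; exact: bounded_byN.
Qed.

Lemma invn_ge0 n : 0 <= n.+1%:R^-1 :> C.
Proof. by rewrite invr_ge0 ler0n. Qed.

Lemma invn_le m n : (m <= n)%N -> n.+1%:R^-1 <= m.+1%:R^-1 :> C.
Proof. by move=> mn; rewrite lef_pV2 ?posrE ?ltr0n// ler_nat. Qed.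

Lemma native_ip_cvg f g : f \in native_set -> g \in native_set ->
  (fun n => pairing f (approx g n)) ~> native_ip f g.
Proof.
move=> /native_bounded[M M0 fM] gS; apply: cvgC_cauchy => e e0.
have [N _ Nlt] : \forall n \near \oo, `|0 - M * (n.+1%:R^-1 + n.+1%:R^-1)| < e%:C%C.
  have : (fun n => M * (n.+1%:R^-1 + n.+1%:R^-1) : C) ~> M * (0 + 0).
    apply: cvgM; first exact: cvg_cst.
    by apply: cvgD; exact: cvgC_invn.
  rewrite addr0 mulr0 => /cvgrPdist_lt; apply.
  by rewrite ltcR.
exists N => m n Nm Nn.
apply: le_trans (pairing_approx M0 (invn_ge0 N) (invn_ge0 N) fM _ _) _.
- exact: bounded_by_le (invn_le Nm) (approxP m gS).
- exact: bounded_by_le (invn_le Nn) (approxP n gS).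
have := Nlt N (leqnn N); rewrite /= sub0r normrN => /ltW; apply: le_trans.
by rewrite real_ler_norm// ger0_real// mulr_ge0// addr_ge0// invn_ge0.
Qed.

(** The limit does not depend on the chosen approximations, with a rate. *)
Lemma native_ip_near f g s M e : f \in native_set -> g \in native_set ->
  0 <= M -> 0 <= e -> bounded_by f M -> bounded_by (g - kcomb K s) e ->
  `|native_ip f g - pairing f s| <= M * e.
Proof.
move=> fS gS M0 e0 fM gs.
apply: (@le_norm_cvgC _ (fun n => pairing f (approx g n) - pairing f s)
   (fun n => M * (n.+1%:R^-1 + e))).
- by apply: cvgB; [exact: native_ip_cvg|exact: cvg_cst].
- rewrite -[e in M * e]add0r; apply: cvgM; first exact: cvg_cst.
  by apply: cvgD; [exact: cvgC_invn|exact: cvg_cst].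
near=> n; apply: pairing_approx => //; exact: approxP.
Unshelve. all: by end_near. Qed.

(** The kernel combination is approximated by itself with error 0. *)
Lemma native_ip_kcomb f s : f \in native_set ->
  native_ip f (kcomb K s) = pairing f s.
Proof.
move=> fS; have [M M0 fM] := native_bounded fS.
apply/eqP; rewrite -subr_eq0 -normr_le0.
have := @native_ip_near f (kcomb K s) s M 0 fS (native_kcomb s) M0 (lexx _) fM.
rewrite mulr0; apply => t.
by rewrite pairingB subrr normr0 mul0r.
Qed.

Lemma native_ip_bound f g M e : f \in native_set -> g \in native_set ->
  0 <= M -> 0 <= e -> bounded_by f M -> bounded_by g e ->
  `|native_ip f g| <= M * e.
Proof.
move=> fS gS M0 e0 fM ge.
have := @native_ip_near f g [::] M e fS gS M0 e0 fM.
by rewrite kcomb_nil subr0 /pairing big_nil subr0; exact.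
Qed.

(** Replacing [f] by its approximations as well does not change the limit, since
the approximations of [g] are bounded. In this form the inner product visibly
inherits symmetry and positivity from the kernel. *)
Lemma native_ip_gram f g : f \in native_set -> g \in native_set ->
  (fun n => gram (approx f n) (approx g n)) ~> native_ip f g.
Proof.
move=> fS gS; have [N N0 gN] := native_bounded gS.
have -> : (fun n => gram (approx f n) (approx g n)) =
    (fun n => pairing f (approx g n) -
       pairing (f - kcomb K (approx f n)) (approx g n)).
  by apply/funext => n; rewrite pairingB opprB addrC subrK.
rewrite -[X in _ ~> X]subr0; apply: cvgB; first exact: native_ip_cvg.
apply: (@squeeze0C _ _ (fun n => n.+1%:R^-1 * (1 + N))).
  rewrite -(mul0r (1 + N)); apply: cvgM; [exact: cvgC_invn|exact: cvg_cst].
move=> n; rewrite sub0r normrN (le_trans (approxP n fS _))//.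
rewrite ler_wpM2l ?invn_ge0// comb_norm_le ?addr_ge0//.
rewrite -[kcomb _ _](subrK g) -opprB.
apply: bounded_byD => //; apply: bounded_byN.
apply: bounded_by_le (approxP n gS).
by rewrite invf_le1 ?ltr0n// ler1n.
Qed.

Lemma native_ip_conj f g : f \in native_set -> g \in native_set ->
  native_ip f g = (native_ip g f)^*.
Proof.
move=> fS gS.
apply: (cvg_unique _ (native_ip_gram fS gS)) => //.
have -> : (fun n => gram (approx f n) (approx g n)) =
    (fun n => (gram (approx g n) (approx f n))^*).
  by apply/funext => n; rewrite gram_conj.
exact: cvgC_conj (native_ip_gram gS fS).
Qed.

Lemma native_ip_linear g a f h : g \in native_set ->
  f \in native_set -> h \in native_set ->
  native_ip (a *: f + h) g = a * native_ip f g + native_ip h g.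
Proof.
move=> gS fS hS; have fhS : a *: f + h \in native_set by rewrite rpredD// rpredZ.
apply: (cvg_unique _ (native_ip_cvg fhS gS)) => //.
have -> : (fun n => pairing (a *: f + h) (approx g n)) =
    (fun n => a * pairing f (approx g n) + pairing h (approx g n)).
  by apply/funext => n; rewrite pairing_linear.
apply: cvgD; last exact: native_ip_cvg.
by apply: cvgM; [exact: cvg_cst|exact: native_ip_cvg].
Qed.

Lemma native_ip_ge0 f : f \in native_set -> 0 <= native_ip f f.
Proof.
move=> fS; apply: (ge0_cvgC (native_ip_gram fS fS)).
by near=> n; exact: kernel_psd.
Unshelve. all: by end_near. Qed.

End NativeSpace.

(** * The Hilbert space structure *)

Section NativeHilbert.
Variables (R : realType) (X : Type) (K : pd_kernel R X).
Local Notation C := R[i].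
Local Notation "u ~> z" := ((u : nat -> C^o) @ \oo --> (z : C^o))
  (at level 70).
Implicit Types (f g h : native_space K) (s t : seq (C * X)).

Definition native_dot f g : C := native_ip K (\val f) (\val g).

Lemma native_dot_linearl g : scalar (native_dot^~ g).
Proof.
move=> a f h; rewrite /native_dot linearP.
by rewrite native_ip_linear//; exact: valP.
Qed.

Lemma native_dot_conj f g : native_dot f g = (native_dot g f)^*.
Proof. by apply: native_ip_conj; exact: valP. Qed.

Lemma native_dot_linearr f : GRing.linear_for (Num.conj \; *%R) (native_dot f).
Proof.
move=> a g h; rewrite native_dot_conj native_dot_linearl rmorphD rmorphM/=.
by rewrite -!native_dot_conj.
Qed.

Lemma native_dot_ge0 f : 0 <= native_dot f f.
Proof. by apply: native_ip_ge0; exact: valP. Qed.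

Lemma native_dot_cauchy_schwarz f g :
  `|native_dot f g| <= sqrtC (native_dot f f) * sqrtC (native_dot g g).
Proof.
apply: cauchy_schwarz_coef; [exact: native_dot_ge0..|move=> a b].
have dotl c u v w : native_dot (c *: u + v) w = c * native_dot u w + native_dot v w.
  exact: native_dot_linearl.
have dotr c u v w : native_dot w (c *: u + v) = c^* * native_dot w u + native_dot w v.
  exact: native_dot_linearr.
have dot0l w : native_dot 0 w = 0.
  by have := dotl (-1) w w w; rewrite scaleN1r addNr mulN1r addNr.
have dot0r w : native_dot w 0 = 0 by rewrite native_dot_conj dot0l conjC0.
have := native_dot_ge0 (a *: f + (b *: g + 0)).
rewrite !dotl !dotr !dot0l !dot0r (native_dot_conj g f).
by congr (0 <= _); ring.
Qed.

Definition native_comb t : native_space K := exist _ (kcomb K t) (native_kcomb K t).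

Lemma native_dot_comb f t : native_dot f (native_comb t) = pairing (\val f) t.
Proof. by apply: native_ip_kcomb; exact: valP. Qed.

(** Together with [ipnorm_native_le], this identifies the Hilbert norm with the
dual norm. *)
Lemma native_dot_bounded_by f :
  bounded_by K (\val f) (sqrtC (native_dot f f)).
Proof.
move=> t; rewrite -native_dot_comb (le_trans (native_dot_cauchy_schwarz _ _))//.
by rewrite native_dot_comb.
Qed.

(** The values of [f] are pairings, and a function of norm 0 has zero pairings. *)
Lemma native_dot_gt0 f : f != 0 -> 0 < native_dot f f.
Proof.
move=> f0; rewrite lt_def native_dot_ge0 andbT.
apply: contra f0 => /eqP ff0; apply/eqP/val_inj/funext => x.
have := native_dot_bounded_by f [:: (1, x)].
by rewrite ff0 sqrtC0 mul0r pairing1 normr_le0 => /eqP.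
Qed.

HB.instance Definition _ :=
  bilinear_isBilinear.Build C (native_space K) (native_space K) C
    ( *%R ) (Num.conj \; *%R) native_dot (native_dot_linearl, native_dot_linearr).

Lemma native_dot_herm f g : native_dot f g = (-1) ^+ false * (native_dot g f)^*.
Proof. by rewrite expr0 mul1r native_dot_conj. Qed.

HB.instance Definition _ :=
  isHermitianSesquilinear.Build C (native_space K) false Num.conj native_dot
    native_dot_herm.

HB.instance Definition _ :=
  isDotProduct.Build C (native_space K) native_dot native_dot_gt0.

Lemma ipnorm_native f :
  (ipnorm (native_dot : {dot native_space K for Num.conj}) f)%:C%C =
  sqrtC (native_dot f f).
Proof.
rewrite -[LHS]sqrCK ?ler0c ?sqrtr_ge0// -rmorphXn sqr_sqrtr.
  by rewrite /= RRe_real// ger0_real// native_dot_ge0.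
by have := native_dot_ge0 f; rewrite lecE => /andP[].
Qed.

Lemma ipnorm_native_le f (e : R) : 0 <= e -> bounded_by K (\val f) e%:C%C ->
  ipnorm (native_dot : {dot native_space K for Num.conj}) f <= e.
Proof.
move=> e0 fe; rewrite -lecR ipnorm_native.
have e0C : 0 <= e%:C%C :> C by rewrite ler0c.
rewrite -(@ler_pXn2r _ 2) ?nnegrE ?sqrtC_ge0 ?native_dot_ge0// sqrtCK expr2.
rewrite -[leLHS]ger0_norm ?native_dot_ge0//.
by apply: native_ip_bound => //; exact: valP.
Qed.

(** A Cauchy sequence is Cauchy for the dual norm, hence pointwise, because point
evaluations are pairings with one-point combinations. Its pointwise limit [F] is
also a limit in the dual norm, since each bound on pairings passes to the limit,
and therefore lies in the closure of the kernel combinations. *)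
Lemma native_hilbert : hilbert (native_dot : {dot native_space K for Num.conj}).
Proof.
move=> u uC.
have cauchy (e : R) : 0 < e -> exists N, forall m n, (N <= m)%N -> (N <= n)%N ->
    bounded_by K (\val (u m) - \val (u n)) e%:C%C.
  move=> e0; have [N uN] := uC e e0; exists N => m n Nm Nn.
  rewrite -raddfB; apply: bounded_by_le (native_dot_bounded_by _).
  by rewrite -ipnorm_native lecR ltW// uN.
pose F x : C := lim ((fun n => (\val (u n) : X -> C) x : C^o) @ \oo).
have uF x : (fun n => (\val (u n) : X -> C) x) ~> F x.
  apply: cvgC_cauchy => e e0.
  (* 1 is added since the seminorm of the point x may vanish. *)
  pose c := 1 + complex.Re (comb_norm K [:: (1, x)]).
  have c0 : 0 < c.
    by rewrite ltr_pwDl// -ler0c RRe_real ?comb_norm_ge0// ger0_real// comb_norm_ge0.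
  have [N uN] := cauchy _ (divr_gt0 e0 c0); exists N => m n Nm Nn.
  have := uN m n Nm Nn [:: (1, x)].
  rewrite pairing1 => /le_trans; apply.
  rewrite -[comb_norm _ _]RRe_real ?ger0_real ?comb_norm_ge0// -rmorphM lecR.
  rewrite -mulrA ler_piMr//; first exact: ltW.
  by rewrite mulrC ler_pdivrMr// mul1r lerDr.
have Fu (e : R) : 0 < e -> exists N, forall n, (N <= n)%N ->
    bounded_by K (F - \val (u n)) e%:C%C.
  move=> e0; have [N uN] := cauchy e e0; exists N => n Nn t.
  apply: (@le_norm_cvgC _ (fun m => pairing (\val (u m) - \val (u n)) t)
     (fun=> e%:C%C * comb_norm K t)).
  - apply: cvg_pairing => x; apply: cvgB; [exact: uF|exact: cvg_cst].
  - exact: cvg_cst.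
  - by exists N => // m /= Nm; exact: uN.
have FS : F \in native_set K.
  apply/native_setP => e e0.
  have eE : e = (complex.Re e)%:C%C by rewrite RRe_real// gtr0_real.
  have Re0 : 0 < complex.Re e / 2 by rewrite divr_gt0// -ltcR -eE.
  have [N FN] := Fu _ Re0.
  have e20 : 0 < (complex.Re e / 2)%:C%C :> C by rewrite ltcR.
  have /native_setP/(_ _ e20)[s us] := valP (u N).
  exists s; rewrite eE [complex.Re e]splitr rmorphD/=.
  rewrite -(subrK (\val (u N)) F) -addrA; apply: bounded_byD => //.
  exact: FN.
exists (exist _ F FS : native_space K).
apply/cvgrPdist_le => e e0; have [N FN] := Fu e e0.
exists N => // n /= Nn; rewrite sub0r normrN ger0_norm ?sqrtr_ge0//.
apply: ipnorm_native_le; first exact: ltW.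
by rewrite raddfB/= -opprB; apply: bounded_byN; exact: FN.
Qed.

(** Moore-Aronszajn theorem: the value of [f] at [y] is its pairing with the
one-point combination at [y], so the section K(., y) reproduces it. *)
Theorem pd_kernel_reproducing : reproducing_kernel K.
Proof.
exists (native_set K), (native_space K), native_dot; split.
  exact: native_hilbert.
move=> y; exists (native_comb [:: (1, y)]); first exact: kcomb1.
by move=> f; rewrite -[LHS]pairing1; exact: esym (native_dot_comb _ _).
Qed.
End NativeHilbert.

(** * Reproducing kernels are positive definite *)

Section Converse.
Variables (R : realType) (X : Type).

(** The kernel is the Gram matrix of its sections K(., x), and the quadratic form
at [s] is the squared norm of the corresponding combination of sections. *)
Lemma reproducing_kernel_pd (K : X -> X -> R[i]) : reproducing_kernel K ->
  (forall x y, K y x = (K x y)^*) /\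
  (forall s, 0 <= pairing (kcomb K s) s).
Proof.
move=> [S [H [ip [_ repr]]]].
pose k y := s2val (cid2 (repr y)).
have kE y : \val (k y) = K^~ y by exact: s2valP (cid2 (repr y)).
have kip y (f : H) : (\val f : X -> R[i]) y = ip f (k y).
  exact: (s2valP' (cid2 (repr y))).
have KE x y : K x y = ip (k y) (k x) by rewrite -kip kE.
split=> [x y|s].
  by rewrite !KE hermC expr0 mul1r.
have -> : pairing (kcomb K s) s =
    ip (\sum_(p <- s) p.1 *: k p.2) (\sum_(p <- s) p.1 *: k p.2).
  rewrite linear_sumr; apply: eq_bigr => q _.
  rewrite linearZr_LR linear_sumlz /=; congr (_ * _).
  by apply: eq_bigr => p _; rewrite linearZl_LR KE.
exact: dnorm_ge0.
Qed.
End Converse.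

(** * Integrals of complex functions *)

Section ComplexIntegral.
Context (R : realType) (d : measure_display) (T : measurableType d).
Variable mu : {measure set T -> \bar R}.
Local Notation C := R[i].
Implicit Types (f g : T -> C) (z w : C).

(** Integrability and the value of the integral are kept together so that both
propagate at once through finite linear combinations. *)
Definition has_integralc f z : Prop :=
  [/\ mu.-integrable setT (EFin \o (fun t => complex.Re (f t))),
      mu.-integrable setT (EFin \o (fun t => complex.Im (f t))) &
      integralc mu f = z].

Let integrable_linear a b (g h : T -> R) :
  mu.-integrable setT (EFin \o g) -> mu.-integrable setT (EFin \o h) ->
  mu.-integrable setT (EFin \o (fun t => a * g t + b * h t)).
Proof.
move=> ig ih.
have := integrableD measurableT (integrableZl measurableT a ig)
                                (integrableZl measurableT b ih).
by apply: eq_integrable.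
Qed.

Let Rintegral_linear a b (g h : T -> R) :
  mu.-integrable setT (EFin \o g) -> mu.-integrable setT (EFin \o h) ->
  \int[mu]_t (a * g t + b * h t) = a * \int[mu]_t g t + b * \int[mu]_t h t.
Proof.
move=> ig ih; rewrite RintegralD ?RintegralZl//.
- by apply: eq_integrable (integrableZl measurableT a ig).
- by apply: eq_integrable (integrableZl measurableT b ih).
Qed.

Lemma has_integralc0 : has_integralc (fun=> 0) 0.
Proof.
split; [exact: integrable0|exact: integrable0|].
by rewrite /integralc /=; congr Complex; rewrite Rintegral_cst// mul0r.
Qed.

Lemma has_integralcD f g z w : has_integralc f z -> has_integralc g w ->
  has_integralc (fun t => f t + g t) (z + w).
Proof.
move=> [fR fI <-] [gR gI <-].
have ReD : (fun t => complex.Re (f t + g t)) =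
    (fun t => 1 * complex.Re (f t) + 1 * complex.Re (g t)).
  by apply/funext => t; rewrite raddfD !mul1r.
have ImD : (fun t => complex.Im (f t + g t)) =
    (fun t => 1 * complex.Im (f t) + 1 * complex.Im (g t)).
  by apply/funext => t; rewrite raddfD !mul1r.
split; rewrite ?/integralc ?ReD ?ImD; [exact: integrable_linear..|].
by rewrite !Rintegral_linear// !mul1r.
Qed.

Lemma has_integralcZ a f z : has_integralc f z ->
  has_integralc (fun t => a * f t) (a * z).
Proof.
case: a => a b [fR fI <-].
have ReZ : (fun t => complex.Re (Complex a b * f t)) =
    (fun t => a * complex.Re (f t) + - b * complex.Im (f t)).
  by apply/funext => t; rewrite mulNr; case: (f t).
have ImZ : (fun t => complex.Im (Complex a b * f t)) =
    (fun t => a * complex.Im (f t) + b * complex.Re (f t)).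
  by apply/funext => t; case: (f t).
split; rewrite ?/integralc ?ReZ ?ImZ; [exact: integrable_linear..|].
by rewrite !Rintegral_linear// mulNr.
Qed.

Lemma has_integralc_sum (I : Type) (r : seq I) (f : I -> T -> C) (z : I -> C) :
  (forall i, has_integralc (f i) (z i)) ->
  has_integralc (fun t => \sum_(i <- r) f i t) (\sum_(i <- r) z i).
Proof.
move=> fz; elim: r => [|i r ih].
  by under eq_fun do rewrite big_nil; rewrite big_nil; exact: has_integralc0.
under eq_fun do rewrite big_cons; rewrite big_cons.
exact: has_integralcD.
Qed.

Lemma has_integralc_ge0 f z : has_integralc f z -> (forall t, 0 <= f t) -> 0 <= z.
Proof.
move=> [_ _ <-] f0; rewrite /integralc lecE /=; apply/andP; split.
  under eq_Rintegral => t _ do rewrite (ger0_Im (f0 t)).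
  by rewrite Rintegral_cst// mul0r.
apply: Rintegral_ge0 => t _.
by have := f0 t; rewrite lecE => /andP[].
Qed.

Lemma integralc_conj f :
  mu.-integrable setT (EFin \o (fun t => complex.Im (f t))) ->
  integralc mu (fun t => (f t)^*) = (integralc mu f)^*.
Proof.
move=> fI; rewrite /integralc /=; congr Complex.
  by apply: eq_Rintegral => t _; case: (f t).
rewrite -mulN1r -RintegralZl//.
by apply: eq_Rintegral => t _; case: (f t) => a b; rewrite mulN1r.
Qed.

End ComplexIntegral.

(** On a finite measure space the modulus, being in L2, is in L1; it dominates the
real and imaginary parts. *)
Lemma L2c_has_integralc (R : realType) (d : measure_display)
    (T : measurableType d) (mu : {finite_measure set T -> \bar R})
    (f : T -> R[i]) : L2c mu f -> has_integralc mu f (integralc mu f).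
Proof.
move=> [mR mI f2].
pose N t := ComplexField.Normc.normc (f t).
have mN : measurable_fun setT N.
  have -> : N = (fun t => Num.sqrt (complex.Re (f t) ^+ 2 + complex.Im (f t) ^+ 2)).
    by apply/funext => t; rewrite /N; case: (f t).
  have msqrt : measurable_fun [set: R] (@Num.sqrt R).
    by apply: continuous_measurable_fun; exact: sqrt_continuous.
  apply: measurableT_comp msqrt _.
  by apply: measurable_funD; exact: measurable_funX.
have iN : mu.-integrable setT (EFin \o N).
  apply/Lfun1_integrable; apply: Lfun_subset12; first exact: fin_num_measure.
  by rewrite inE; apply/andP; split; rewrite inE.
have dom (h : T -> R) : measurable_fun setT h -> (forall t, `|h t| <= N t) ->
    mu.-integrable setT (EFin \o h).
  move=> mh hN; apply: le_integrable iN => //; first exact/measurable_EFinP.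
  move=> t _ /=; rewrite lee_fin (le_trans (hN t))// ler_norm//.
split => //; apply: dom => // t; rewrite -lecR.
- exact: normc_ge_Re.
- exact: normC_ge_Im.
Qed.

(** * Integrals of reproducing kernels *)

Section IntegratedKernel.
Context (R : realType) (X : Type) (d : measure_display) (T : measurableType d).
Variable mu : {measure set T -> \bar R}.

(** Symmetry and nonnegativity of the quadratic forms involve finitely many values
of the kernels, so that they can be integrated. *)
Lemma reproducing_kernel_integral (K : T -> X -> X -> R[i]) (L : X -> X -> R[i]) :
  (forall t, reproducing_kernel (K t)) ->
  (forall x y, has_integralc mu (fun t => K t x y) (L x y)) ->
  reproducing_kernel L.
Proof.
move=> Kpd KL.
have Lherm x y : L y x = (L x y)^*.
  have [_ _ <-] := KL y x; have [_ KI <-] := KL x y.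
  rewrite -integralc_conj//; congr integralc; apply/funext => t.
  by have [-> _] := reproducing_kernel_pd (Kpd t).
have Lpsd s : 0 <= pairing (kcomb L s) s.
  apply: (@has_integralc_ge0 _ _ _ mu (fun t => pairing (kcomb (K t) s) s)); last first.
    by move=> t; have [_ ->] := reproducing_kernel_pd (Kpd t).
  apply: has_integralc_sum => q; apply: has_integralcZ.
  by apply: has_integralc_sum => p; exact: has_integralcZ.
exact: pd_kernel_reproducing (PdKernel Lherm Lpsd).
Qed.
End IntegratedKernel.

Theorem corollary4p4 (R : realType) (X : metricType R)
    (d : measure_display) (Omega : measurableType d)
    (mu : {finite_measure set Omega -> \bar R})
    (phi : R -> Omega -> R[i])
    (X_separable : separable_space X)
    (phi_L2 : forall delta : R, 0 <= delta -> L2c mu (phi delta))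
    (phi_continuous : forall omega : Omega,
       {within `[0, +oo[, continuous (fun delta : R => phi delta omega : R[i]^o)})
    (phi_rbf : forall omega : Omega,
       radial_basis_function X (fun delta : R => phi delta omega)) :
  radial_basis_function X (fun delta : R => integralc mu (phi delta)).
Proof.
apply: (reproducing_kernel_integral phi_rbf) => x y.
by apply: L2c_has_integralc; apply: phi_L2; exact: mdist_ge0.
Qed.
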